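(* Let $0<\theta<1$ be fixed. For the $\theta$-biased riffle shuffle measure $P_\theta$ on the symmetric group $\mathfrak{S}_n$, let $$k=\left\lfloor\frac{2\log n-\log 2+c}{-\log(\theta^2+(1-\theta)^2)}\right\rfloor .$$ Then $$\mathrm{SEP}(k)\sim 1-\exp(-e^{-c}),\qquad \ell_\infty(k)\sim \exp(e^{-c})-1,$$ for any fixed real $c$ as $n$ tends to $\infty$.
   Context: The $\theta$-biased riffle shuffle measure $P_\theta$ on the symmetric group $\mathfrak{S}_n$: start with a deck of $n$ cards in the order $1,2,\ldots,n$ from top to bottom (the identity). Cut off the top $N$ cards as the left pile, where $N$ has the binomial$(n,\theta)$ distribution, the remaining $n-N$ cards forming the right pile. Then drop cards one at a time from the bottoms of the piles: if the left pile currently has $A$ cards and the right pile $B$ cards, the next card is dropped from the bottom of the left pile with probability $A/(A+B)$ and otherwise from the bottom of the right pile; continue until all cards are dropped into a single pile. $P_\theta(w)$ is the probability that the resulting arrangement of the deck, read from top to bottom, is the permutation $w=w(1)w(2)\cdots w(n)$. Convolution powers: $P_\theta^{*0}$ is the point mass at the identity and $P_\theta^{*k}(w)=\sum_{v\in\mathfrak{S}_n}P_\theta(v)P_\theta^{*(k-1)}(v^{-1}w)$ for $k\ge1$. The uniform distribution is $U(w)=1/n!$. Distances to uniform after $k$ shuffles of $n$ cards: the separation distance is $\mathrm{SEP}(k)=\max_{w\in\mathfrak{S}_n}\left(1-\frac{P_\theta^{*k}(w)}{U(w)}\right)$ and the $\ell_\infty$ distance is $\ell_\infty(k)=\max_{w\in\mathfrak{S}_n}\left|1-\frac{P_\theta^{*k}(w)}{U(w)}\right|$.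 The notation $f\sim g$ means that $f/g\to1$ as $n\to\infty$, and $\lfloor x\rfloor$ is the greatest integer not exceeding $x$.
   Formalization: Because of the floor in k the printed limits fail (θ=1/2, c=0: SEP(k)→1−e^{-2} along n=⌊2^j√2⌋); on the right-hand sides c is replaced by c_n, defined by k=(2 log n − log 2 + c_n)/(−log(θ²+(1−θ)²)), so c_n=c when no rounding occurs. *)

(* Defs.v *)
From HB Require Import structures.
From mathcomp Require Import all_boot all_order all_algebra all_fingroup.
From mathcomp Require Import all_classical all_reals all_analysis.

Set Implicit Arguments.
Unset Strict Implicit.
Unset Printing Implicit Defensive.

Import Order.TTheory GRing.Theory Num.Theory.
Local Open Scope ring_scope.

(* Cards and positions are both numbered 0, ..., n-1 instead of 1, ..., n, so
   that an arrangement of the deck is a permutation w : 'S_n, and w i is the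
   card in the i-th position from the top. *)
Definition arrangement (n : nat) (w : 'S_n) : seq 'I_n :=
  [seq w i | i <- enum 'I_n].

(* The probability that two piles l and r, both listed from bottom to top, are
   dropped in the order s. Since the first card dropped ends up at the bottom,
   s lists the resulting pile from bottom to top as well. *)
Fixpoint drop_prob (R : realType) (T : eqType) (s l r : seq T) : R :=
  if s is x :: s' then
    let A : R := (size l)%:R in
    let B : R := (size r)%:R in
    (if l is a :: l' then
       A / (A + B) * ((x == a)%:R * drop_prob R s' l' r) else 0)
    + (if r is b :: r' then
         B / (A + B) * ((x == b)%:R * drop_prob R s' l r') else 0)
  else ((l == [::]) && (r == [::]))%:R.

Definition riffle (R : realType) (theta : R) (n : nat) (w : 'S_n) : R :=
  \sum_(N < n.+1) binomial_pmf n theta N *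
    drop_prob R (rev (arrangement w))
      (rev (take N (enum 'I_n))) (rev (drop N (enum 'I_n))).

(* Permutations in MathComp compose from left to right: (w * v^-1)%g maps i to
   v^-1 (w i), so it is the usual v^-1 w. *)
Definition convolution (R : realType) (n : nat) (P Q : 'S_n -> R) :
    'S_n -> R :=
  fun w => \sum_(v : 'S_n) P v * Q (w * v^-1)%g.

Definition riffle_pow (R : realType) (theta : R) (n k : nat) : 'S_n -> R :=
  iter k (convolution (riffle theta (n := n))) (fun w => (w == 1%g)%:R).

Definition uniform_perm (R : realType) (n : nat) (w : 'S_n) : R :=
  (n`!%:R)^-1.

(* The initial value f 1 is one of the values of f, so this is the maximum of
   f over 'S_n, whatever the signs of these values. *)
Definition max_perm (R : realType) (n : nat) (f : 'S_n -> R) : R :=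
  \big[Num.max/f 1%g]_(w : 'S_n) f w.

Definition SEP (R : realType) (theta : R) (n k : nat) : R :=
  max_perm (fun w : 'S_n =>
    1 - riffle_pow theta k w / uniform_perm R w).

Definition linfty (R : realType) (theta : R) (n k : nat) : R :=
  max_perm (fun w : 'S_n =>
    `|1 - riffle_pow theta k w / uniform_perm R w|).

Definition shuffle_time (R : realType) (theta c : R) (n : nat) : R :=
  (2 * ln n%:R - ln 2 + c) / - ln (theta ^+ 2 + (1 - theta) ^+ 2).

(* Num.truncn is the floor of a nonnegative real and 0 on negative reals; for
   0 < theta < 1, shuffle_time theta c n is nonnegative for all large n. *)
Definition shuffle_count (R : realType) (theta c : R) (n : nat) : nat :=
  Num.truncn (shuffle_time theta c n).

(* The number c_n such that shuffle_time theta c_n n, without rounding, is the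
   integer shuffle_count theta c n. It equals c when shuffle_time theta c n is
   itself a nonnegative integer; in general, for 0 < theta < 1 and n large,
     c + ln (theta ^+ 2 + (1 - theta) ^+ 2) < c_n <= c.
   The difference does not tend to 0 as n grows: the fractional part of
   shuffle_time theta c n is dense in [0, 1], and one shuffle more or less
   shifts c by - ln (theta ^+ 2 + (1 - theta) ^+ 2). Hence c_n, and not c,
   gives the asymptotics after shuffle_count theta c n shuffles. *)
Definition rounded_shift (R : realType) (theta c : R) (n : nat) : R :=
  (shuffle_count theta c n)%:R * - ln (theta ^+ 2 + (1 - theta) ^+ 2)
  - (2 * ln n%:R - ln 2).

(* Main.v *)
Require Import Defs.
From mathcomp Require Import all_boot all_order all_algebra all_fingroup.
From mathcomp Require Import all_classical all_reals all_analysis.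
From mathcomp Require Import ring lra zify.
Import Order.TTheory GRing.Theory Num.Theory.
Import numFieldNormedType.Exports.
Local Open Scope ring_scope.
Set Implicit Arguments.
Unset Strict Implicit.
Unset Printing Implicit Defensive.

(** A riffle shuffle is easiest to describe backwards. Label every position of
the shuffled deck with the pile, left or right, from which its card was
dropped. These labels are independent, left with probability theta, and they
determine the arrangement: the cards are numbered by sorting the positions by
label, equal labels being kept in the order of their positions
([riffle_label_measure]). If the labels of one shuffle are refined by the
labels of a later one, the composite is again of this kind, with pairs of
labels ordered lexicographically ([convolution_label_measure]). After k
shuffles every position thus carries an independent random word x of k letters,
whose weight p_x is a product of k factors theta or 1 - theta, and the deck is
the standardization of the random sequence of words ([riffle_pow_words]).

So n! P^{*k}(w) is n! times the total weight of the sequences of n words with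
standardization w. Read in the order given by w, these sequences are weakly
increasing, and every strictly increasing sequence occurs among them. The
probability is therefore greatest at the identity, where all weakly increasing
sequences occur and the sum is the complete symmetric function h_n(p), and
least at the reversed deck, where only the strictly increasing ones occur and
the sum is the elementary symmetric function e_n(p). Hence the separation
distance is 1 - n! e_n(p), while the other distance is at least n! h_n(p) - 1
and at most the larger of n! h_n(p) - 1 and 1 - n! e_n(p)
([riffle_pow_extremes]).

What is left is a birthday problem, n! e_n(p) being the probability that n
random words are distinct. Let s_j be the sum of the p_x^j, and let A_m be
m! e_m(p) with eps = -1, or m! h_m(p) with eps = 1. Newton's identities give
A_{m+1} = A_m + eps m s_2 A_{m-1} + terms with s_3, s_4, ..., and comparing
with the exponential gives |A_n - exp(eps n^2 s_2 / 2)| <= C n max p, where C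
depends on n^2 s_2 only ([newton_asymptotics]). Power sums are multiplicative
in k, so s_2 = q^k with q = theta^2 + (1 - theta)^2, and n^2 s_2 / 2 is exactly
exp(-c_n), where c_n is the rounded shift; it stays between two positive
constants. Finally max p = m^k with m = max(theta, 1 - theta), and m^2 < q
makes m^k of smaller order than the square root of q^k, which is of order 1/n.
So n max p tends to 0 ([deck_times_max_weight_small]), and both distances are
asymptotic to the stated functions of c_n, which are bounded away from 0. *)

(** * Symmetric functions and Newton identities *)

Definition psum (R : realType) (s : seq R) (j : nat) : R := \sum_(x <- s) x ^+ j.

Fixpoint elementary_sym (R : realType) (s : seq R) (m : nat) : R :=
  match s, m with
  | _, 0 => 1
  | [::], _.+1 => 0
  | x :: s', m'.+1 => elementary_sym s' m'.+1 + x * elementary_sym s' m'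
  end.

(** The inner recursion keeps the head letter available after it has been used,
because a letter may be repeated in a complete symmetric function. *)
Fixpoint complete_sym (R : realType) (s : seq R) : nat -> R :=
  match s with
  | [::] => fun m => (m == 0)%:R
  | x :: s' => fix h m := if m is m'.+1 then complete_sym s' m'.+1 + x * h m' else 1
  end.

(** Newton's identities for both families at once: the sign eps is 1 for the
complete and -1 for the elementary symmetric functions. The asymptotic analysis
uses nothing else about either family. *)
Definition newton (R : realType) (eps : R) (s : seq R) (a : nat -> R) : Prop :=
  a 0 = 1 /\ forall m, m.+1%:R * a m.+1 =
    \sum_(j < m.+1) eps ^+ j * psum s j.+1 * a (m - j)%N.

Lemma psum_cons (R : realType) (x : R) s j : psum (x :: s) j = x ^+ j + psum s j.
Proof. by rewrite /psum big_cons. Qed.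

Lemma elementary_sym0 (R : realType) (s : seq R) : elementary_sym s 0 = 1.
Proof. by case: s. Qed.

Lemma complete_sym0 (R : realType) (s : seq R) : complete_sym s 0 = 1.
Proof. by case: s. Qed.


(** Adding a letter x multiplies the generating function by 1 / (1 - x z). The
right-hand side for x :: s therefore splits into T, from the powers of x, and
S', from the power sums of s; both satisfy the recursion in m that defines the
complete symmetric functions, and the identity follows by a second induction. *)
Lemma newton_complete_sym (R : realType) (s : seq R) : newton 1 s (complete_sym s).
Proof.
split; first exact: complete_sym0.
elim: s => [|x s IHs].
  move=> m /=; rewrite mulr0 big1// => j _.
  by rewrite /psum big_nil mulr0 mul0r.
have [h' h'E] : exists h', h' = complete_sym (x :: s) by eexists.
rewrite -h'E.
pose T m : R := \sum_(j < m.+1) x ^+ j.+1 * h' (m - j)%N.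
pose S' m : R := \sum_(j < m.+1) psum s j.+1 * h' (m - j)%N.
have h'0 : h' 0 = 1 by rewrite h'E.
have hS m : h' m.+1 = complete_sym s m.+1 + x * h' m by rewrite h'E.
have TS m : T m.+1 = x * h' m.+1 + x * T m.
  rewrite /T big_ord_recl subn0 expr1 mulr_sumr; congr (_ + _).
  by apply: eq_bigr => j _; rewrite /= /bump /= add1n subSS exprS mulrA.
have S'S m : S' m.+1 = m.+2%:R * complete_sym s m.+2 + x * S' m.
  rewrite IHs /S' big_ord_recr [in RHS]big_ord_recr /= subnn complete_sym0 h'0.
  rewrite expr1n !mul1r addrAC; congr (_ + _).
  rewrite mulr_sumr -big_split /=; apply: eq_bigr => j _.
  by rewrite expr1n mul1r (subSn (leq_ord j)) hS mulrDr mulrCA.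
have main m : m.+1%:R * h' m.+1 = T m + S' m.
  elim: m => [|m IHm].
    have := IHs 0; rewrite /T /S' !big_ord1 hS subnn h'0 complete_sym0.
    by rewrite expr0 expr1 !mulr1 !mul1r => ->; rewrite addrC.
  rewrite TS S'S addrACA -mulrDr -IHm hS.
  by move: (complete_sym s _) (h' m) => a b; rewrite -!natr1; ring.
move=> m; rewrite main -big_split /=; apply: eq_bigr => j _.
by rewrite psum_cons expr1n mul1r mulrDl.
Qed.

(** Adding a letter x multiplies the generating function by 1 + x z. Because of
the alternating signs, the part T coming from the powers of x telescopes. *)
Lemma newton_elementary_sym (R : realType) (s : seq R) : newton (- 1) s (elementary_sym s).
Proof.
split; first exact: elementary_sym0.
elim: s => [|x s IHs].
  move=> m /=; rewrite mulr0 big1// => j _.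
  by rewrite /psum big_nil mulr0 mul0r.
have [e' e'E] : exists e', e' = elementary_sym (x :: s) by eexists.
rewrite -e'E.
have e'0 : e' 0 = 1 by rewrite e'E.
have eS m : e' m.+1 = elementary_sym s m.+1 + x * elementary_sym s m by rewrite e'E.
pose T m : R := \sum_(j < m.+1) (- 1) ^+ j * x ^+ j.+1 * e' (m - j)%N.
pose S' m : R := \sum_(j < m.+1) (- 1) ^+ j * psum s j.+1 * e' (m - j)%N.
have TE m : T m = x * elementary_sym s m.
  elim: m => [|m IHm].
    by rewrite /T big_ord1 subnn elementary_sym0 e'0 expr0 expr1 mul1r.
  transitivity (x * e' m.+1 - x * T m); last first.
      by rewrite IHm eS mulrDr -addrA subrr addr0.
  rewrite /T big_ord_recl subn0 expr1 expr0 mul1r mulr_sumr -sumrN.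
  congr (_ + _); apply: eq_bigr => j _.
  by rewrite /= /bump /= add1n subSS ![_ ^+ _.+1]exprS; ring.
have S'E m : S' m = m.+1%:R * elementary_sym s m.+1 + x * (m%:R * elementary_sym s m).
  case: m => [|m].
    by rewrite IHs /S' !big_ord1 subnn elementary_sym0 e'0 mul0r mulr0 addr0.
  rewrite !IHs /S' big_ord_recr [in RHS]big_ord_recr /= subnn elementary_sym0 e'0.
  rewrite [RHS]addrAC; congr (_ + _).
  rewrite mulr_sumr -big_split /=; apply: eq_bigr => j _.
  by rewrite (subSn (leq_ord j)) eS mulrDr [_ * (x * _)]mulrCA.
move=> m; transitivity (T m + S' m).
  rewrite TE S'E eS.
  by move: (elementary_sym s m) (elementary_sym s m.+1) => a b; rewrite -!natr1; ring.
rewrite -big_split /=; apply: eq_bigr => j _.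
by rewrite psum_cons mulrDr mulrDl.
Qed.

Lemma psum_ge0 (R : realType) (s : seq R) j :
  (forall x, x \in s -> 0 <= x) -> 0 <= psum s j.
Proof.
by move=> s0; rewrite /psum big_seq sumr_ge0// => x xs; rewrite exprn_ge0// s0.
Qed.

(** With i = 2 this bounds every higher power sum by the second one, so that the
second power sum and the largest weight control all terms of Newton's
identities. *)
Lemma psum_le (R : realType) (s : seq R) (M : R) i j :
  (forall x, x \in s -> 0 <= x <= M) -> psum s (i + j) <= psum s i * M ^+ j.
Proof.
move=> sM; rewrite /psum mulr_suml big_seq [leRHS]big_seq.
apply: ler_sum => x /sM /andP[x0 xM].
by rewrite exprD ler_wpM2l ?exprn_ge0// lerXn2r// nnegrE (le_trans x0).
Qed.

(** * The birthday problem *)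

Lemma sum_geometric_le2 (R : realType) (d : R) m :
  0 <= d <= 1 / 2 -> \sum_(j < m) d ^+ j <= 2.
Proof.
move=> /andP[d0 d2]; elim: m => [|m IHm]; first by rewrite big_ord0.
rewrite big_ord_recl expr0.
rewrite (eq_bigr (fun j : 'I_m => d * d ^+ j)); last first.
  by move=> j _; rewrite /= /bump /= add1n exprS.
rewrite -mulr_sumr.
have : d * \sum_(j < m) d ^+ j <= 1 / 2 * 2.
  by apply: ler_pM => //; apply: sumr_ge0 => j _; exact: exprn_ge0.
lra.
Qed.

(** Both sides come from 1 + y <= expR y, at y = x and at y = - x; the latter
gives expR x <= 1 / (1 - x). *)
Lemma expR_quadratic (R : realType) (x : R) :
  `|x| <= 1 / 2 -> `|expR x - 1 - x| <= 2 * x ^+ 2.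
Proof.
rewrite ler_norml => /andP[xl xr]; rewrite ler_norml.
have h1 := expR_ge1Dx x; have h2 := expR_ge1Dx (- x).
have e0 := expR_gt0 x.
have : expR x * (1 - x) <= 1.
  by rewrite -[leRHS](expRxMexpNx_1 x) ler_pM2l.
move=> h3; have sq : 0 <= x ^+ 2 by exact: sqr_ge0.
apply/andP; split; first by lra.
have : (1 - x) * (expR x - 1 - x) <= (1 - x) * (2 * x ^+ 2).
  have : 0 <= x ^+ 2 * (1 - 2 * x) by apply: mulr_ge0 => //; lra.
  rewrite expr2; nra.
by rewrite ler_pM2l //; lra.
Qed.

Lemma expR_norm_le (R : realType) (x y : R) :
  `|x| <= y -> expR x <= expR y.
Proof. by move=> xy; rewrite ler_expR (le_trans (ler_norm _)). Qed.

Lemma leq_ffact_exp (m j : nat) : (m ^_ j <= m ^ j)%N.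
Proof.
by elim: j => // j IHj; rewrite ffactnSr expnSr leq_mul// leq_subr.
Qed.

(** The abstract form of the birthday estimate. Here A m stands for m! a_m and
c j for the power sum of exponent j + 1, so that the recurrence is Newton's
identity multiplied by m!. In this scale the terms j >= 2 contribute
O(s n d) to A (m + 1) for d = n M, hence O(L d) over n steps, and the two
remaining terms act as multiplication by 1 + eps m s. Up to an error of the
same size this is the factor by which expR (eps s m^2 / 2) grows from m to
m + 1, so the quotient of the two sequences stays close to 1. *)
Lemma birthday_recurrence (R : realType) (n : nat) (eps s M : R)
    (c A : nat -> R) (L := n%:R ^+ 2 * s) :
  `|eps| <= 1 -> 0 <= s <= M -> n%:R * M <= 1 / 2 ->
  c 0 = 1 -> c 1 = s -> (forall j, `|c j.+1| <= s * M ^+ j) -> A 0 = 1 ->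
  (forall m, A m.+1 =
     \sum_(j < m.+1) eps ^+ j * (m ^_ j)%:R * c j * A (m - j)%N) ->
  `|A n - expR (eps * (L / 2))| <= (6 * L + 1) * expR (3 * L) * (n%:R * M).
Proof.
move=> eps1 /andP[s0 sM] d2 c0 c1 cM A0 AS.
have M0 : 0 <= M by lra.
have n0 : 0 <= n%:R :> R by [].
pose d := n%:R * M; pose al := n%:R * s.
have d0 : 0 <= d by exact: mulr_ge0.
have al0 : 0 <= al by exact: mulr_ge0.
have ald : al <= d by exact: ler_wpM2l.
have LE : L = n%:R * al by rewrite /L /al; ring.
have L0 : 0 <= L by rewrite LE mulr_ge0.
have dh : 0 <= d <= 1 / 2 by rewrite d0.
pose t m j := eps ^+ j * (m ^_ j)%:R * c j * A (m - j)%N.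
have tM K m j : (m < n)%N -> (forall i, (i <= m)%N -> `|A i| <= K) ->
    `|t m j.+1| <= K * al * d ^+ j.
  move=> mn AK; rewrite /t !normrM normrX normr_nat.
  have -> : K * al * d ^+ j = (1 * n%:R ^+ j.+1) * (s * M ^+ j) * K.
    by rewrite /al /d exprMn exprS; ring.
  apply: ler_pM => //; last by apply: AK; rewrite leq_subr.
  apply: ler_pM => //; apply: ler_pM => //; first by rewrite exprn_ile1.
  rewrite -natrX ler_nat (leq_trans (leq_ffact_exp _ _))//.
  by rewrite leq_exp2r// ltnW.
have sumt K m : (m < n)%N -> (forall i, (i <= m)%N -> `|A i| <= K) ->
    `|A m.+1 - A m| <= 2 * (K * al).
  move=> mn AK; have K0 : 0 <= K by apply: le_trans (AK 0%N _).
  rewrite AS big_ord_recl /= ffactn0 subn0 expr0 c0 !mul1r addrAC subrr add0r.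
  apply: le_trans (ler_norm_sum _ _ _) _.
  apply: (@le_trans _ _ (\sum_(j < m) K * al * d ^+ j)).
    by apply: ler_sum => j _; exact: tM.
  rewrite -mulr_sumr mulrC ler_wpM2r ?mulr_ge0//; exact: sum_geometric_le2.
(* An a priori bound on A: each step multiplies the running maximum by at most
   1 + 2 al, the constant 2 being the sum of a geometric series of ratio 1 / 2. *)
have AKm m : (m <= n)%N ->
    forall i, (i <= m)%N -> `|A i| <= (1 + 2 * al) ^+ m.
  elim: m => [_ i|m IHm mn i].
    by rewrite leqn0 => /eqP ->; rewrite A0 normr1 expr0.
  have K0 : 0 <= (1 + 2 * al) ^+ m by apply: exprn_ge0; lra.
  have Km : (1 + 2 * al) ^+ m.+1 =
      (1 + 2 * al) ^+ m + 2 * ((1 + 2 * al) ^+ m * al) by rewrite exprS; ring.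
  have Ka : 0 <= (1 + 2 * al) ^+ m * al by exact: mulr_ge0.
  rewrite leq_eqVlt => /orP[/eqP ->|im]; last first.
    have := IHm (ltnW mn) i im; lra.
  have h1 := IHm (ltnW mn) m (leqnn m).
  have h2 := sumt _ _ mn (IHm (ltnW mn)).
  have := ler_normD (A m) (A m.+1 - A m); rewrite addrC subrK; lra.
pose K := expR (2 * L).
have K0 : 0 <= K by exact: expR_ge0.
have AK i : (i <= n)%N -> `|A i| <= K.
  move=> ni; apply: le_trans (AKm n (leqnn n) i ni) _.
  have -> : K = expR (2 * al) ^+ n.
    by rewrite /K -expRM_natl; congr expR; rewrite LE; ring.
  rewrite lerXn2r ?nnegrE ?expR_ge0//; first lra.
  exact: expR_ge1Dx.
(* One step of the recurrence is, up to an error, multiplication by the ratio of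
   expR (eps s m^2 / 2) at m + 1 and at m; this explains the term 1 / 2. *)
have step m : (m < n)%N ->
    `|A m.+1 - expR (eps * (s * (m%:R + 1 / 2))) * A m|
      <= K * (6 * al * d + s).
  move=> mn; set x := eps * _.
  have AKm' i : (i <= m)%N -> `|A i| <= K.
    by move=> im; apply: AK; rewrite (leq_trans im)// ltnW.
  have m0 : 0 <= m%:R :> R by [].
  have mn' : m%:R + 1 <= n%:R :> R by rewrite natr1 ler_nat.
  have xal : `|x| <= al.
    have h0 : 0 <= s * (m%:R + 1 / 2) by apply: mulr_ge0 => //; lra.
    rewrite /x normrM (ger0_norm h0) -[leRHS]mul1r; apply: ler_pM => //.
    by rewrite /al [leRHS]mulrC; apply: ler_wpM2l => //; lra.
  have ex : `|expR x - 1 - x| <= 2 * al ^+ 2.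
    apply: le_trans (expR_quadratic _) _; first by lra.
    by rewrite ler_pM2l// -real_normK ?num_real// lerXn2r ?nnegrE.
  (* Replacing A (m - 1) by A m in the second term costs only O(al^2). *)
  have first_order : `|A m.+1 - A m - eps * (m%:R * s) * A m|
      <= K * (4 * al * d).
    case: m mn AKm' {xal ex} @x m0 mn' => [|m] mn AKm' x m0 mn'.
      rewrite AS big_ord1 /= A0 c0 ffactn0 expr0 !mul1r.
      by rewrite mul0r mulr0 mul0r subr0 subrr normr0 !mulr_ge0//; lra.
    have -> : A m.+2 - A m.+1 - eps * (m.+1%:R * s) * A m.+1 =
        \sum_(j < m) t m.+1 j.+2 - eps * (m.+1%:R * s) * (A m.+1 - A m).
      rewrite AS !big_ord_recl /= ffactn0 subn0 expr0 c0 !mul1r.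
      rewrite /bump /= !add1n ffactn1 expr1 c1 subSS subn0.
      rewrite (eq_bigr (fun j : 'I_m => t m.+1 j.+2)) //.
      move: (\sum_(j < m) _) (A m.+1) (A m) (m.+1%:R : R) => S a b e; ring.
    apply: le_trans (ler_normB _ _) _.
    have h1 : `|\sum_(j < m) t m.+1 j.+2| <= K * (2 * al * d).
      apply: le_trans (ler_norm_sum _ _ _) _.
      apply: (@le_trans _ _ (\sum_(j < m) (K * al * d) * d ^+ j)).
        apply: ler_sum => j _; apply: le_trans (tM K _ _ mn AKm') _.
        by rewrite exprS mulrA.
      have -> : K * (2 * al * d) = K * al * d * 2 by ring.
      by rewrite -mulr_sumr ler_wpM2l ?mulr_ge0//; exact: sum_geometric_le2.
    have h2 : `|eps * (m.+1%:R * s) * (A m.+1 - A m)| <= al * (2 * (K * al)).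
      rewrite normrM; apply: ler_pM => //.
        rewrite normrM -[leRHS]mul1r; apply: ler_pM => //.
        rewrite ger0_norm ?mulr_ge0// /al ler_wpM2r//; lra.
      by apply: sumt => [|i im]; [exact: ltnW | apply: AKm'; exact: leqW].
    have h3 : K * al * al <= K * al * d by rewrite ler_wpM2l// mulr_ge0.
    by move: h1 h2 h3; move: (m.+1%:R) => z; lra.
  have -> : A m.+1 - expR x * A m = (A m.+1 - A m - eps * (m%:R * s) * A m)
      - (expR x - 1 - x) * A m - (eps * (s / 2)) * A m.
    by rewrite /x; move: (expR _) => e; field.
  have b1 : `|(expR x - 1 - x) * A m| <= (2 * al ^+ 2) * K.
    by rewrite normrM; apply: ler_pM => //; exact: AKm'.
  have b2 : `|(eps * (s / 2)) * A m| <= (1 * (s / 2)) * K.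
    rewrite normrM; apply: ler_pM => //; last exact: AKm'.
    have h0 : 0 <= s / 2 by exact: divr_ge0.
    by rewrite normrM (ger0_norm h0); apply: ler_pM.
  have h3 : K * al * al <= K * al * d by rewrite ler_wpM2l// mulr_ge0.
  have h4 : 0 <= K * s by exact: mulr_ge0.
  apply: le_trans (ler_normB _ _) _.
  have := ler_normB (A m.+1 - A m - eps * (m%:R * s) * A m)
    ((expR x - 1 - x) * A m).
  move: first_order b1 b2 h3 h4; rewrite expr2.
  by move=> *; lra.
(* The factor expR (L / 2) in E bounds the inverse of G. *)
pose G m := expR (eps * (s * m%:R ^+ 2 / 2)).
pose E := K * (6 * al * d + s) * expR (L / 2).
have GL x m : (m <= n)%N -> `|x| <= 1 -> expR (x * (s * m%:R ^+ 2 / 2)) <= expR (L / 2).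
  move=> mn x1; apply: expR_norm_le.
  rewrite normrM -[leRHS]mul1r; apply: ler_pM => //.
  rewrite ger0_norm ?divr_ge0 ?mulr_ge0 ?exprn_ge0//.
  by rewrite ler_pM2r// /L mulrC ler_wpM2r// lerXn2r ?nnegrE ?ler_nat.
have drift m : (m <= n)%N -> `|A m / G m - 1| <= m%:R * E.
  elim: m => [_|m IHm mn].
    by rewrite A0 /G expr0n /= !mulr0 !mul0r mulr0 expR0 divr1 subrr normr0.
  have GS : G m.+1 = expR (eps * (s * (m%:R + 1 / 2))) * G m.
    by rewrite /G -expRD -natr1; congr expR; field.
  have Gn0 : G m != 0 by rewrite gt_eqF// expR_gt0.
  have GSn0 : G m.+1 != 0 by rewrite gt_eqF// expR_gt0.
  have -> : A m.+1 / G m.+1 - 1 = (A m / G m - 1)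
      + (A m.+1 - expR (eps * (s * (m%:R + 1 / 2))) * A m) * (G m.+1)^-1.
    have en0 : expR (eps * (s * (m%:R + 1 / 2))) != 0 by rewrite gt_eqF// expR_gt0.
    rewrite GS invfM; move: Gn0 en0; move: (expR _) (G m) => e g g0 e0.
    by field; rewrite g0 e0.
  apply: le_trans (ler_normD _ _) _.
  have -> : m.+1%:R * E = m%:R * E + E by rewrite -natr1; ring.
  apply: lerD; first exact/IHm/ltnW.
  rewrite normrM; apply: ler_pM => //; first exact: step.
  rewrite ger0_norm ?invr_ge0 ?expR_ge0// /G -expRN -mulNr; apply: GL => //.
  by rewrite normrN.
have := drift n (leqnn n).
have Gn0 : G n != 0 by rewrite gt_eqF// expR_gt0.
have GnE : G n = expR (eps * (L / 2)) by rewrite /G /L [s * _]mulrC.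
have -> : A n - expR (eps * (L / 2)) = (A n / G n - 1) * G n.
  by rewrite mulrBl divfK// mul1r GnE.
move=> dr; rewrite normrM.
apply: (@le_trans _ _ (n%:R * E * expR (L / 2))).
  apply: ler_pM => //; rewrite ger0_norm ?expR_ge0//.
  exact: GL.
have -> : n%:R * E * expR (L / 2) = (6 * L * d + al) * expR (3 * L).
  have -> : expR (3 * L) = K * (expR (L / 2) * expR (L / 2)).
    by rewrite /K -!expRD; congr expR; field.
  by rewrite /E LE /al; ring.
rewrite [leRHS]mulrAC ler_wpM2r ?expR_ge0// -/d; lra.
Qed.

Lemma newton_asymptotics (R : realType) (n : nat) (eps M : R) (s : seq R)
    (a : nat -> R) (L := n%:R ^+ 2 * psum s 2) :
  `|eps| <= 1 -> newton eps s a -> psum s 1 = 1 ->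
  (forall x, x \in s -> 0 <= x <= M) -> n%:R * M <= 1 / 2 ->
  `|n`!%:R * a n - expR (eps * (L / 2))|
    <= (6 * L + 1) * expR (3 * L) * (n%:R * M).
Proof.
move=> eps1 [a0 aS] s1 sM nM.
have s0 x : x \in s -> 0 <= x by move=> /sM /andP[].
have psM i j := @psum_le R s M i j sM.
apply: (@birthday_recurrence _ _ _ _ _ (fun j => psum s j.+1)
         (fun m => m`!%:R * a m)) => //.
- by rewrite psum_ge0//=; have := psM 1 1; rewrite s1 mul1r.
- by move=> j; rewrite ger0_norm ?psum_ge0//; exact: psM 2 j.
- by rewrite a0 mulr1.
- move=> m; rewrite factS natrM mulrAC -mulrA [a _ * _]mulrC.
  rewrite mulrCA mulrC.
  rewrite -[_ * a _ * _]mulrC aS mulr_sumr; apply: eq_bigr => j _.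
  by rewrite -(ffact_fact (leq_ord j)) natrM; ring.
Qed.

(** * Standardization of labels *)

(** Labels first, positions second: this is the order in which the cards are
numbered when the positions are sorted stably by label. *)
Definition lex_lt (n : nat) (a : 'I_n -> nat) (i j : 'I_n) : bool :=
  (a i < a j)%N || ((a i == a j) && (i < j)%N).

(** The classical standardization of the word a: the unique permutation with the
same inversions as a, equal letters being read from left to right. *)
Definition standardizes (n : nat) (a : 'I_n -> nat) (w : 'S_n) : bool :=
  [forall i, forall j, (w i < w j)%N == lex_lt a i j].

(** The law of the standardization of n independent labels with weights p, where
rk lists the alphabet T in increasing order. For an alphabet of two letters it
is one riffle shuffle; the family is closed under convolution, which a single
alphabet would not be. *)
Definition label_measure (R : realType) (T : finType) (rk : T -> nat)
    (p : T -> R) (n : nat) (w : 'S_n) : R :=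
  \sum_(f : {ffun 'I_n -> T})
    (standardizes (fun i => rk (f i)) w)%:R * \prod_i p (f i).

Lemma standardizesP (n : nat) (a : 'I_n -> nat) (w : 'S_n) :
  reflect (forall i j, (w i < w j)%N = lex_lt a i j) (standardizes a w).
Proof.
apply: (iffP forallP) => h i; last by apply/forallP => j; rewrite h.
by move=> j; have /forallP/(_ j)/eqP := h i.
Qed.

Lemma lex_lt_irr (n : nat) (a : 'I_n -> nat) i : lex_lt a i i = false.
Proof. by rewrite /lex_lt !ltnn andbF. Qed.

Lemma lex_lt_trans (n : nat) (a : 'I_n -> nat) : transitive (lex_lt a).
Proof.
move=> j i k /orP[ij|/andP[/eqP ij ltij]] /orP[jk|/andP[/eqP jk ltjk]].
- by rewrite /lex_lt (ltn_trans ij jk).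
- by rewrite /lex_lt -jk ij.
- by rewrite /lex_lt ij jk.
- by rewrite /lex_lt ij jk eqxx (ltn_trans ltij ltjk) orbT.
Qed.

Lemma lex_lt_total (n : nat) (a : 'I_n -> nat) i j :
  i != j -> lex_lt a i j || lex_lt a j i.
Proof.
by rewrite /lex_lt -val_eqE /= eq_sym [a j == _]eq_sym; case: ltngtP => //=; case: ltngtP.
Qed.

Lemma card_ord_lt (n m : nat) :
  (m <= n)%N -> #|[set x : 'I_n | (x < m)%N]| = m.
Proof.
move=> mn; have widen_inj : injective (widen_ord mn).
  by move=> x y /(congr1 val) xy; apply: val_inj.
rewrite -[RHS](card_ord m) -(card_imset _ widen_inj).
apply: eq_card => x. rewrite inE; apply/idP/imsetP => [xm|[y _ ->]].
  by exists (Ordinal xm) => //; apply: val_inj.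
exact: (ltn_ord y).
Qed.

(** A permutation of an initial segment is determined by the order relation that
it induces on positions; this gives the uniqueness of standardizations. *)
Lemma perm_rank (n : nat) (w : 'S_n) (i : 'I_n) :
  #|[set j | (w j < w i)%N]| = w i.
Proof.
rewrite -[RHS](card_ord_lt (ltnW (ltn_ord (w i)))).
rewrite -[RHS](card_preimset _ (@perm_inj _ w)).
by apply: eq_card => j; rewrite !inE.
Qed.

(** The value at i has to be the number of positions that precede i in the
lexicographic order, and this rank function is a permutation because the order
is total. *)
Lemma unique_standardization (n : nat) (a : 'I_n -> nat) :
  exists u : 'S_n, forall w, standardizes a w = (w == u).
Proof.
pose r (i : 'I_n) := #|[set j | lex_lt a j i]|.
have rn i : (r i < n)%N.
  rewrite -[n in (_ < n)%N]card_ord -cardsT; apply: proper_card.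
  by rewrite properT; apply/eqP => /setP/(_ i); rewrite !inE lex_lt_irr.
have rS i j : lex_lt a i j -> (r i < r j)%N.
  move=> ij; apply: proper_card; apply/properP; split.
    by apply/fintype.subsetP => k; rewrite !inE => /lex_lt_trans; apply.
  by exists i; rewrite inE ?lex_lt_irr.
have r_inj : injective (fun i => Ordinal (rn i)).
  move=> i j [rij]; apply/eqP; apply: contraT => /(lex_lt_total a).
  by case/orP => /rS; rewrite rij ltnn.
exists (perm r_inj) => w; set u := perm _.
apply/standardizesP/eqP => [h|-> i j].
  apply/permP => i; rewrite permE; apply: val_inj => /=.
  rewrite -(perm_rank w i); apply: eq_card => j.
  by rewrite !inE h.
rewrite !permE /=; apply/idP/idP; last exact: rS.
apply: contraLR => nij; rewrite -leqNgt.
have [->//|ji] := eqVneq i j.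
by have := lex_lt_total a ji; rewrite (negbTE nij) => /rS/ltnW.
Qed.

Lemma sum_standardizes (R : realType) (n : nat) (a : 'I_n -> nat) :
  \sum_(w : 'S_n) (standardizes a w)%:R = 1 :> R.
Proof.
have [u uE] := unique_standardization a.
rewrite (bigD1 u)//= uE eqxx big1 ?addr0// => w wu.
by rewrite uE (negbTE wu).
Qed.

(** With a single letter all labels are equal, and stable sorting changes nothing:
this is the case of no shuffle at all. *)
Lemma label_measure_unit (R : realType) (n : nat) (w : 'S_n) :
  label_measure (fun _ : unit => 0) (fun=> 1 : R) w = (w == 1%g)%:R.
Proof.
rewrite /label_measure; pose f0 : {ffun 'I_n -> unit} := [ffun=> tt].
rewrite (bigD1 f0)//= [X in _ + X]big1 ?addr0 => [|f]; last first.
  by case/eqP; apply/ffunP => i; case: (f i) (f0 i) => -[].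
rewrite big1 ?mulr1//; congr (_%:R); congr nat_of_bool.
apply/standardizesP/eqP => [h|-> i j]; last first.
  by rewrite /lex_lt ltnn eqxx !perm1.
apply/permP => i; rewrite perm1; apply: val_inj => /=.
rewrite -(perm_rank w i) -[RHS](card_ord_lt (ltnW (ltn_ord i))).
by apply: eq_card => j; rewrite !inE h /lex_lt ltnn eqxx.
Qed.

(** The pairs of labels (a i, b i), ordered lexicographically, are encoded by one
number, b i being a digit in base B. *)
Lemma lex_lt_pair (n B : nat) (a b : 'I_n -> nat) i j :
  (forall i, b i < B)%N ->
  lex_lt (fun i => a i * B + b i)%N i j =
  (a i < a j)%N || ((a i == a j) && lex_lt b i j).
Proof.
move=> bB; rewrite /lex_lt; have bi := bB i; have bj := bB j.
case: (ltngtP (a i) (a j)) => [ij|ij|->] /=; last first.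
- by rewrite ltn_add2l eqn_add2l.
- have : (a j * B + b j < a i * B + b i)%N by nia.
  by move=> h; rewrite ltnNge (ltnW h) /= gtn_eqF.
- by have -> : (a i * B + b i < a j * B + b j)%N by nia.
Qed.

(** Write w = u * v, where u standardizes g and v standardizes labels that sit on
the positions after u. Pulled back along u these labels become labels f of the
original positions, with the same total weight, and w compares two positions
first by f and then by u, that is by f, then by g, then by position. So w
standardizes the pairs (f, g). Each g has exactly one standardization u, so the
sum over u disappears. *)
Lemma convolution_label_measure (R : realType) (T1 T2 : finType)
    (rk1 : T1 -> nat) (rk2 : T2 -> nat) (p1 : T1 -> R) (p2 : T2 -> R)
    (B : nat) (n : nat) (w : 'S_n) :
  (forall x, rk2 x < B)%N ->
  convolution (label_measure rk1 p1 (n:=n)) (label_measure rk2 p2 (n:=n)) w =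
  label_measure (fun x : T1 * T2 => rk1 x.1 * B + rk2 x.2)%N
    (fun x => p1 x.1 * p2 x.2) w.
Proof.
move=> rkB; rewrite /convolution /label_measure.
under eq_bigr do rewrite mulr_sumr.
rewrite exchange_big /=.
pose W (g : {ffun 'I_n -> T2}) (f : {ffun 'I_n -> T1}) : R :=
  (standardizes (fun i => rk1 (f i) * B + rk2 (g i))%N w)%:R
    * \prod_i p1 (f i) * \prod_i p2 (g i).
transitivity (\sum_g \sum_f W g f).
  apply: eq_bigr => g _.
  transitivity (\sum_(u : 'S_n) (standardizes (fun i => rk2 (g i)) u)%:R
      * \sum_f W g f); last by rewrite -mulr_suml sum_standardizes mul1r.
  rewrite (reindex_inj (h := fun u => (u^-1 * w)%g)) /=; last first.
    by move=> u v /mulIg/invg_inj.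
  apply: eq_bigr => u _; rewrite invMg invgK mulKVg.
  case: standardizesP => [uP|_]; last by rewrite !(mul0r, mulr0).
  rewrite !mul1r mulr_suml.
  pose h (f : {ffun 'I_n -> T1}) : {ffun 'I_n -> T1} := [ffun i => f ((u^-1)%g i)].
  rewrite (reindex_inj (h := h)) /=; last first.
    move=> f1 f2 /ffunP f12; apply/ffunP => i.
    by have := f12 (u i); rewrite !ffunE permK.
  apply: eq_bigr => f _; rewrite /W; congr (_ * _); congr (_ %:R * _).
    congr nat_of_bool; apply/standardizesP/standardizesP => H i j.
      have := H (u i) (u j); rewrite !permM !permK => ->.
      by rewrite lex_lt_pair// /lex_lt !ffunE !permK uP.
    have := H ((u^-1)%g i) ((u^-1)%g j); rewrite !permM => ->.
    by rewrite lex_lt_pair// -uP !permKV /lex_lt !ffunE.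
  rewrite (reindex_inj (@perm_inj _ u)) /=.
  by apply: eq_bigr => i _; rewrite ffunE permK.
rewrite exchange_big pair_big /=.
rewrite [RHS](reindex (fun fg : {ffun 'I_n -> T1} * {ffun 'I_n -> T2} =>
   [ffun i => (fg.1 i, fg.2 i)])) /=; last first.
  exists (fun f => ([ffun i => (f i).1], [ffun i => (f i).2])).
    by move=> [f g] _ /=; congr (_, _); apply/ffunP => i; rewrite !ffunE.
  by move=> f _; apply/ffunP => i; rewrite !ffunE /=; case: (f i).
apply: eq_bigr => -[f g] _ /=; rewrite /W -mulrA -big_split /=.
congr (_ %:R * _); last by apply: eq_bigr => i _; rewrite ffunE.
congr nat_of_bool; apply/standardizesP/standardizesP => H i j;
  by rewrite H /lex_lt !ffunE.
Qed.

(** * The least and most likely arrangements *)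

(** The relation r is leq for weakly and ltn for strictly increasing sequences. *)
Definition monotone_sum (R : realType) (T : finType) (rk : T -> nat)
    (p : T -> R) (r : rel nat) (n : nat) : R :=
  \sum_(f : {ffun 'I_n -> T} |
      [forall i : 'I_n, forall j : 'I_n, (i < j)%N ==> r (rk (f i)) (rk (f j))])
    \prod_i p (f i).

(** Listing the labels by card instead of by position moves w from the labels to
the tie-breaking rule. All permutations are then compared through conditions on
one and the same sequence g, and w matters only where g has ties. *)
Lemma label_measure_perm (R : realType) (T : finType) (rk : T -> nat)
    (p : T -> R) (n : nat) (w : 'S_n) :
  label_measure rk p w = \sum_(g : {ffun 'I_n -> T})
    [forall i : 'I_n, forall j : 'I_n, ((i < j)%N) ==
       (rk (g i) < rk (g j))%N
       || ((rk (g i) == rk (g j)) && ((w^-1)%g i < (w^-1)%g j)%N)]%:R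
     * \prod_i p (g i).
Proof.
rewrite /label_measure.
pose h (g : {ffun 'I_n -> T}) : {ffun 'I_n -> T} := [ffun i => g (w i)].
rewrite (reindex_inj (h := h)) /=; last first.
  move=> f1 f2 /ffunP f12; apply/ffunP => i.
  by have := f12 ((w^-1)%g i); rewrite !ffunE permKV.
apply: eq_bigr => g _; congr (_ %:R * _); last first.
  rewrite [RHS](reindex_inj (@perm_inj _ w)) /=.
  by apply: eq_bigr => i _; rewrite ffunE.
congr nat_of_bool; apply/standardizesP/forallP => H.
  move=> i; apply/forallP => j.
  have := H ((w^-1)%g i) ((w^-1)%g j).
  by rewrite /lex_lt !ffunE !permKV => ->.
move=> i j; have /forallP/(_ (w j))/eqP -> := H (w i).
by rewrite /lex_lt !ffunE !permK.
Qed.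

(** Whatever the tie-breaking rule, the labels listed by card increase weakly. *)
Lemma label_measure_le (R : realType) (T : finType) (rk : T -> nat)
    (p : T -> R) (n : nat) (w : 'S_n) :
  (forall x, 0 <= p x) -> label_measure rk p w <= monotone_sum rk p leq n.
Proof.
move=> p0; rewrite label_measure_perm /monotone_sum [leRHS]big_mkcond /=.
apply: ler_sum => g _; have P0 : 0 <= \prod_i p (g i) by exact: prodr_ge0.
case: (boolP [forall i, _]) => [/forallP H|_]; rewrite ?(mul1r, mul0r); last first.
  by case: ifP.
rewrite ifT//; apply/forallP => i; apply/forallP => j; apply/implyP => ij.
by have /forallP/(_ j)/eqP := H i; rewrite ij; case: ltngtP.
Qed.

(** A strictly increasing sequence has no ties, so it contributes to every w. *)
Lemma label_measure_ge (R : realType) (T : finType) (rk : T -> nat)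
    (p : T -> R) (n : nat) (w : 'S_n) :
  (forall x, 0 <= p x) -> monotone_sum rk p ltn n <= label_measure rk p w.
Proof.
move=> p0; rewrite label_measure_perm /monotone_sum [leLHS]big_mkcond /=.
apply: ler_sum => g _; have P0 : 0 <= \prod_i p (g i) by exact: prodr_ge0.
case: ifP => [/forallP H|_]; last by rewrite mulr_ge0.
suff -> : [forall i : 'I_n, forall j : 'I_n, ((i < j)%N) == (rk (g i) < rk (g j))%N
   || ((rk (g i) == rk (g j)) && ((w^-1)%g i < (w^-1)%g j)%N)].
  by rewrite mul1r.
apply/forallP => i; apply/forallP => j.
have Hij : (i < j)%N -> (rk (g i) < rk (g j))%N.
  by move=> ij; have /forallP/(_ j)/implyP/(_ ij) := H i.
have Hji : (j < i)%N -> (rk (g j) < rk (g i))%N.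
  by move=> ij; have /forallP/(_ i)/implyP/(_ ij) := H j.
case: (ltngtP i j) => [/Hij ->//|/Hji ji|/val_inj ->].
  by rewrite ltnNge (ltnW ji) (gtn_eqF ji).
by rewrite !ltnn andbF.
Qed.

(** At the identity all ties are broken in increasing order, so that every weakly
increasing sequence contributes. *)
Lemma label_measure_id (R : realType) (T : finType) (rk : T -> nat)
    (p : T -> R) (n : nat) :
  label_measure rk p (1%g : 'S_n) = monotone_sum rk p leq n.
Proof.
rewrite label_measure_perm /monotone_sum [RHS]big_mkcond /=.
apply: eq_bigr => g _.
suff -> : [forall i : 'I_n, forall j : 'I_n, ((i < j)%N) == (rk (g i) < rk (g j))%N
   || ((rk (g i) == rk (g j)) && ((1^-1 : 'S_n)%g i < (1^-1 : 'S_n)%g j)%N)] =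
  [forall i : 'I_n, forall j : 'I_n, (i < j)%N ==> (rk (g i) <= rk (g j))%N].
  by case: ifP => _; rewrite ?(mul1r, mul0r).
rewrite invg1; apply/forallP/forallP => H i; apply/forallP => j.
  have /forallP/(_ j)/eqP := H i; rewrite !perm1.
  by case: (i < j)%N => //=; case: ltngtP.
have Hij : (i < j)%N -> (rk (g i) <= rk (g j))%N.
  by move=> ij; have /forallP/(_ j)/implyP/(_ ij) := H i.
have Hji : (j < i)%N -> (rk (g j) <= rk (g i))%N.
  by move=> ij; have /forallP/(_ i)/implyP/(_ ij) := H j.
rewrite !perm1; case: (ltngtP i j) => [/Hij|/Hji|/val_inj ->].
- by rewrite andbT orbC -leq_eqVlt => ->.
- by rewrite andbF orbF ltnNge => ->.
- by rewrite ltnn andbF.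
Qed.

(** At the reversal all ties are broken in decreasing order, which excludes every
sequence with a tie. *)
Lemma label_measure_rev (R : realType) (T : finType) (rk : T -> nat)
    (p : T -> R) (n : nat) :
  label_measure rk p (perm (@rev_ord_inj n)) = monotone_sum rk p ltn n.
Proof.
rewrite label_measure_perm /monotone_sum [RHS]big_mkcond /=.
apply: eq_bigr => g _; set w := perm _.
have wV i : (w^-1)%g i = rev_ord i.
  by apply: (@perm_inj _ w); rewrite permKV permE rev_ordK.
have wlt i j : ((w^-1)%g i < (w^-1)%g j)%N = (j < i)%N.
  by rewrite !wV /=; have := ltn_ord i; have := ltn_ord j; lia.
suff -> : [forall i : 'I_n, forall j : 'I_n, ((i < j)%N) == (rk (g i) < rk (g j))%N
   || ((rk (g i) == rk (g j)) && ((w^-1)%g i < (w^-1)%g j)%N)] =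
  [forall i : 'I_n, forall j : 'I_n, (i < j)%N ==> (rk (g i) < rk (g j))%N].
  by case: ifP => _; rewrite ?(mul1r, mul0r).
apply/forallP/forallP => H i; apply/forallP => j.
  have /forallP/(_ j)/eqP := H i; rewrite wlt.
  by case: (ltngtP i j) => //= _; rewrite andbF orbF => <-.
have Hij : (i < j)%N -> (rk (g i) < rk (g j))%N.
  by move=> ij; have /forallP/(_ j)/implyP/(_ ij) := H i.
have Hji : (j < i)%N -> (rk (g j) < rk (g i))%N.
  by move=> ij; have /forallP/(_ i)/implyP/(_ ij) := H j.
rewrite wlt; case: (ltngtP i j) => [/Hij ->//|/Hji h|/val_inj ->].
- by rewrite andbT ltnNge (ltnW h) (gtn_eqF h).
- by rewrite ltnn andbF.
Qed.

(** * Monotone sequences and symmetric functions *)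

(** The same sum as [monotone_sum], but over lists with letters in s: this allows
an induction on the alphabet s, which is the recursion of the symmetric
functions. *)
Definition sorted_sum (R : realType) (T : finType) (rk : T -> nat)
    (p : T -> R) (r : rel nat) (s : seq T) (n : nat) : R :=
  \sum_(t : n.-tuple T | sorted (relpre rk r) t && all (mem s) t)
    \prod_(x <- t) p x.

Lemma monotone_sum_sorted (R : realType) (T : finType) (rk : T -> nat)
    (p : T -> R) (r : rel nat) (s : seq T) (n : nat) :
  transitive r -> (forall x, x \in s) ->
  monotone_sum rk p r n = sorted_sum rk p r s n.
Proof.
move=> r_tr s_all; rewrite /monotone_sum /sorted_sum.
rewrite (reindex (fun t : n.-tuple T => [ffun i => tnth t i])) /=; last first.
  exists (fun f : {ffun 'I_n -> T} => [tuple f i | i < n]).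
    by move=> t _; apply: eq_from_tnth => i; rewrite tnth_mktuple ffunE.
  by move=> f _; apply/ffunP => i; rewrite ffunE tnth_mktuple.
apply: eq_big => [t|t _]; last first.
  by rewrite big_tuple; apply: eq_bigr => i _; rewrite ffunE.
have -> : all (mem s) t by apply/allP => x _; exact: s_all.
have rr_tr : transitive (relpre rk r) by move=> ? ? ?; exact: r_tr.
rewrite andbT (sorted_pairwise rr_tr).
case: n t => [|n] t.
  by rewrite [t]tuple0; apply/forallP => -[].
apply/forallP/(pairwiseP (thead t)) => H i.
  move=> j; rewrite !inE size_tuple => ilt jlt ij.
  have /forallP/(_ (Ordinal jlt))/implyP/(_ ij) := H (Ordinal ilt).
  by rewrite !ffunE !(tnth_nth (thead t)).
apply/forallP => j; apply/implyP => ij.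
have := H i j; rewrite !inE size_tuple !ltn_ord => /(_ isT isT ij).
by rewrite !ffunE !(tnth_nth (thead t)).
Qed.

Lemma sorted_sum0 (R : realType) (T : finType) (rk : T -> nat)
    (p : T -> R) (r : rel nat) (s : seq T) : sorted_sum rk p r s 0 = 1.
Proof.
rewrite /sorted_sum (big_pred1 [tuple]) ?big_nil// => t.
by rewrite [t]tuple0 /= eqxx.
Qed.

Lemma sorted_sum_nil (R : realType) (T : finType) (rk : T -> nat)
    (p : T -> R) (r : rel nat) n : sorted_sum rk p r [::] n.+1 = 0.
Proof.
rewrite /sorted_sum big_pred0// => t.
by case/tupleP: t => x t; rewrite /= andbF.
Qed.

(** Split by whether the first entry is the smallest letter x. If it is not, then
x does not occur at all; if it is, the remaining entries are sorted with letters
in s', which still contains x for weakly increasing sequences and no longer does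
for strictly increasing ones. *)
Lemma sorted_sum_cons (R : realType) (T : finType) (rk : T -> nat)
    (p : T -> R) (r : rel nat) (x : T) (s s' : seq T) n :
  transitive r -> (forall i j, r i j -> i <= j)%N ->
  (forall y, y \in s -> (rk x < rk y)%N) ->
  (forall y, r (rk x) (rk y) && (y \in x :: s) = (y \in s')) ->
  sorted_sum rk p r (x :: s) n.+1 =
    sorted_sum rk p r s n.+1 + p x * sorted_sum rk p r s' n.
Proof.
move=> r_tr r_le xs s'E.
have rr_tr : transitive (relpre rk r) by move=> ? ? ?; exact: r_tr.
rewrite /sorted_sum (bigID (fun t : n.+1.-tuple T => thead t != x)) /=.
congr (_ + _).
  apply: eq_bigl => t; case/tupleP: t => y t; rewrite theadE /=.
  apply/idP/idP.
    move=> /andP[/andP[yt /andP[]]]; rewrite inE => /orP[/eqP ->|ys].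
      by rewrite eqxx.
    move=> tall _; rewrite yt ys /=; apply/allP => z zt.
    have := allP tall z zt; rewrite inE => /orP[/eqP zx|//].
    move: yt; rewrite path_sortedE// => /andP[/allP/(_ z zt) /= /r_le].
    by rewrite zx leqNgt xs.
  move=> /and3P[yt ys /allP tall]; rewrite yt inE ys orbT /=; apply/andP; split.
    by apply/allP => z /tall zs; rewrite /= inE; apply/orP; right.
  by apply/eqP => yx; have := xs _ ys; rewrite yx ltnn.
rewrite mulr_sumr.
rewrite (reindex_onto (fun t : n.-tuple T => [tuple of x :: t])
           (fun t => [tuple of behead t])); last first.
  move=> t; case/tupleP: t => y t; rewrite theadE negbK => /andP[_ /eqP ->].
  by apply: val_inj.
apply: eq_big => [t|t _]; last by rewrite big_cons.
have -> : [tuple of behead [tuple of x :: t]] = t by exact: val_inj.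
rewrite theadE !eqxx negbK !andbT /= path_sortedE// mem_head /= -andbA andbCA; congr (_ && _).
rewrite -all_predI; apply: eq_all => y; rewrite /= -s'E.
by rewrite /= inE.
Qed.

Lemma sorted_sum_complete (R : realType) (T : finType) (rk : T -> nat)
    (p : T -> R) (s : seq T) n :
  sorted (relpre rk ltn) s -> sorted_sum rk p leq s n = complete_sym (map p s) n.
Proof.
elim: s n => [|x s IHs] n.
  by case: n => [|n] _ /=; rewrite ?sorted_sum0 ?sorted_sum_nil.
move=> /= xs; have ss := path_sorted xs.
have rlt y : y \in s -> (rk x < rk y)%N.
  move=> ys; move: xs; rewrite path_sortedE; last by move=> ? ? ?; exact: ltn_trans.
  by case/andP => /allP/(_ y ys).
elim: n => [|n IHn]; first by rewrite sorted_sum0.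
rewrite (@sorted_sum_cons _ _ _ _ _ x s (x :: s))//; last 2 first.
- exact: leq_trans.
- move=> y; rewrite inE andbC; case: eqVneq => [->|_] /=; first by rewrite leqnn.
  by case: (boolP (y \in s)) => // /rlt/ltnW ->.
by rewrite IHs// IHn.
Qed.

Lemma sorted_sum_elementary (R : realType) (T : finType) (rk : T -> nat)
    (p : T -> R) (s : seq T) n :
  sorted (relpre rk ltn) s -> sorted_sum rk p ltn s n = elementary_sym (map p s) n.
Proof.
elim: s n => [|x s IHs] n.
  by case: n => [|n] _ /=; rewrite ?sorted_sum0 ?sorted_sum_nil.
move=> /= xs; have ss := path_sorted xs.
have rlt y : y \in s -> (rk x < rk y)%N.
  move=> ys; move: xs; rewrite path_sortedE; last by move=> ? ? ?; exact: ltn_trans.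
  by case/andP => /allP/(_ y ys).
case: n => [|n]; first by rewrite sorted_sum0.
rewrite (@sorted_sum_cons _ _ _ _ _ x s s)//; last 3 first.
- exact: ltn_trans.
- by move=> i j /ltnW.
- move=> y; rewrite inE; case: eqVneq => [->|_] /=.
    by rewrite ltnn; apply/esym/negP => /rlt; rewrite ltnn.
  by case: (boolP (y \in s)) => [/rlt -> //|_]; rewrite andbF.
by rewrite !IHs.
Qed.

Definition letter_weights (R : realType) (T : finType) (rk : T -> nat)
    (p : T -> R) : seq R := map p (path.sort (relpre rk leq) (enum T)).

Lemma psum_letter_weights (R : realType) (T : finType) (rk : T -> nat)
    (p : T -> R) j : psum (letter_weights rk p) j = \sum_x p x ^+ j.
Proof.
rewrite /psum /letter_weights big_map -[RHS]big_enum.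
by apply: perm_big; rewrite perm_sort.
Qed.

Lemma monotone_sum_symmetric (R : realType) (T : finType) (rk : T -> nat)
    (p : T -> R) n : injective rk ->
  monotone_sum rk p leq n = complete_sym (letter_weights rk p) n
  /\ monotone_sum rk p ltn n = elementary_sym (letter_weights rk p) n.
Proof.
move=> rk_inj; set s := path.sort (relpre rk leq) (enum T).
have s_all x : x \in s by rewrite mem_sort mem_enum.
have ss : sorted (relpre rk ltn) s.
  rewrite -sorted_map ltn_sorted_uniq_leq map_inj_uniq// sort_uniq enum_uniq.
  by rewrite sorted_map sort_sorted// => x y; exact: leq_total.
split; rewrite (@monotone_sum_sorted _ _ _ _ _ s)//.
- exact: sorted_sum_complete.
- exact: leq_trans.
- exact: sorted_sum_elementary.
- exact: ltn_trans.
Qed.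

(** * One riffle shuffle *)

Lemma big_tuple_cons (R : realType) (T : finType) n (F : n.+1.-tuple T -> R) :
  \sum_t F t = \sum_x \sum_(t : n.-tuple T) F [tuple of x :: t].
Proof.
rewrite pair_big /= (reindex (fun xt : T * n.-tuple T => [tuple of xt.1 :: xt.2]))//=.
exists (fun t => (thead t, [tuple of behead t])).
  by move=> [x t] _; rewrite theadE; congr (_, _); apply: val_inj.
by move=> t _; rewrite -tuple_eta.
Qed.

(** Every interleaving of the two piles is equally likely: when A and B cards are
left, choosing a pile with probability A / (A + B) or B / (A + B) is what makes
each interleaving have probability 1 / 'C(A + B, A). An interleaving is
recorded by a mask m which tells the cards of the right pile. *)
Lemma drop_prob_masks (R : realType) (T : eqType) (n : nat) (s l r : seq T) :
  size s = n -> (size l + size r)%N = n ->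
  drop_prob R s l r * 'C(n, size l)%:R =
  \sum_(m : n.-tuple bool) ((mask (map negb m) s == l) && (mask m s == r))%:R.
Proof.
elim: n s l r => [|n IHn] s l r.
  move=> /size0nil -> /eqP; rewrite addn_eq0 !size_eq0 => /andP[/eqP -> /eqP ->].
  rewrite /= bin0 mulr1 (eq_bigr (fun=> 1)) => [|t _].
    by rewrite sumr_const card_tuple expn0.
  by rewrite [t]tuple0.
case: s => // x s [sn] lrn.
rewrite big_tuple_cons big_bool /= addrC mulrDl; congr (_ + _).
  case: l lrn => [|a l] lrn.
    by rewrite mul0r big1.
  rewrite (eq_bigr (fun m : n.-tuple bool => (x == a)%:R *
    ((mask (map negb m) s == l) && (mask m s == r))%:R)) => [|m _]; last first.
    by rewrite /= eqseq_cons -andbA -mulnb natrM.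
  rewrite -mulr_sumr -IHn//; last by move: lrn => /= [].
  rewrite -natrD lrn /=.
  have n0 : n.+1%:R != 0 :> R by rewrite pnatr_eq0.
  have := mul_bin_diag n.+1 (size l) => /(congr1 (fun k => k%:R : R)).
  rewrite !natrM /= => e.
  transitivity ((x == a)%:R * drop_prob R s l r *
     ((size l).+1%:R * 'C(n.+1, (size l).+1)%:R) / n.+1%:R).
    by field.
  by rewrite -e; field.
case: r lrn => [|b r] lrn.
  by rewrite mul0r big1// => m _; rewrite andbF.
rewrite (eq_bigr (fun m : n.-tuple bool => (x == b)%:R *
    ((mask (map negb m) s == l) && (mask m s == r))%:R)) => [|m _]; last first.
  by rewrite /= eqseq_cons andbCA -mulnb natrM.
have lr : (size l + size r)%N = n by move: lrn; rewrite /= addnS => -[].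
rewrite -mulr_sumr -IHn//.
rewrite -natrD lrn /=.
have n0 : n.+1%:R != 0 :> R by rewrite pnatr_eq0.
have := mul_bin_down n.+1 (size l) => /(congr1 (fun k => k%:R : R)).
have -> : (n.+1 - size l = (size r).+1)%N by lia.
rewrite !natrM /= => e.
transitivity ((x == b)%:R * drop_prob R s l r *
   ((size r).+1%:R * 'C(n.+1, size l)%:R) / n.+1%:R).
  by field.
by rewrite -e; field.
Qed.

(** The positions marked left and then those marked right, each in increasing
order, form the list L of all positions sorted by (label, position). The deck
arises from the shuffle with mask m when w maps L to the cards in their
original order, which is to say that w increases along L. *)
Lemma arrangement_masks (n : nat) (m : n.-tuple bool) (w : 'S_n) :
  (mask (map negb m) (arrangement w) ++ mask m (arrangement w) == enum 'I_n)
  = standardizes (fun i => nat_of_bool (tnth m i)) w.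
Proof.
set a := fun i => _; pose f := tnth m.
have [e eE] : exists e, e = enum 'I_n by eexists.
rewrite -eE.
pose L := [seq i <- e | ~~ f i] ++ [seq i <- e | f i].
have LE (v : 'S_n) : mask (map negb m) (arrangement v) ++ mask m (arrangement v)
    = map v L.
  have fE : map (fun i => ~~ f i) e = map negb m.
    by rewrite (map_comp negb f) eE map_tnth_enum.
  have fE' : map f e = m by rewrite eE map_tnth_enum.
  by rewrite /L /arrangement -eE map_cat !filter_mask fE fE' ![map v (mask _ _)]map_mask.
have e_all i : i \in e by rewrite eE mem_enum.
have L_all i : i \in L by rewrite mem_cat !mem_filter e_all !andbT orbC orbN.
have e_sorted : sorted (relpre val ltn) e.
  by rewrite -sorted_map eE val_enum_ord iota_ltn_sorted.
(* The converse needs no second argument: w and the standardization u of a both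
   send L to the same list, so they are equal. *)
have std_sort v : standardizes a v -> map v L = e.
  move/standardizesP => vP.
  apply: (irr_sorted_eq (leT := relpre val ltn)) => //.
  - by move=> ? ? ?; exact: ltn_trans.
  - by move=> i /=; rewrite ltnn.
  - rewrite sorted_map (eq_sorted (e' := lex_lt a)) => [|i j]; last exact: vP.
    rewrite (sorted_pairwise (@lex_lt_trans _ a)) pairwise_cat.
    have e_lex (P : pred 'I_n) (b : bool) : (forall i, P i -> a i = b) ->
        pairwise (lex_lt a) [seq i <- e | P i].
      move=> Pb.
      have tr : transitive (relpre (val : 'I_n -> nat) ltn).
        by move=> ? ? ?; exact: ltn_trans.
      have := sorted_filter tr P e_sorted.
      rewrite (sorted_pairwise tr); apply: sub_in_pairwise (allss _) => i j.
      rewrite !mem_filter => /andP[/Pb ai _] /andP[/Pb aj _] /= ij.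
      by rewrite /lex_lt ai aj eqxx ij orbT.
    apply/and3P; split.
    + apply/allrelP => i j; rewrite !mem_filter => /andP[fi _] /andP[fj _].
      by rewrite /lex_lt /a -!/(f _) (negbTE fi) fj.
    + by apply: (e_lex _ false) => i /negbTE; rewrite /a -/(f _) => ->.
    + by apply: (e_lex _ true) => i; rewrite /a -/(f _) => ->.
  - move=> i; rewrite e_all; apply/mapP; exists ((v^-1)%g i) => //.
    by rewrite permKV.
rewrite LE; apply/eqP/idP => [wL|]; last exact: std_sort.
have [u uE] := unique_standardization a.
have := std_sort u; rewrite !uE eqxx => /(_ isT) uL.
apply/eqP/permP => i.
have /eq_in_map : map w L = map u L by rewrite wL uL.
exact.
Qed.

Definition bit_weight (R : realType) (theta : R) (b : bool) : R :=
  if b then 1 - theta else theta.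

(** The binomial coefficient in the law of the cut cancels the number of
interleavings of the two piles, so that every mask with N entries left gets the
weight theta^N (1 - theta)^(n - N): its entries are independent. *)
Lemma riffle_label_measure (R : realType) (theta : R) (n : nat) (w : 'S_n) :
  riffle theta w = label_measure nat_of_bool (bit_weight theta) w.
Proof.
set e := enum 'I_n; have sze : size e = n by rewrite size_enum_ord.
pose aw := arrangement w; have sza : size aw = n by rewrite size_map.
pose D N (m : n.-tuple bool) :=
  (mask (map negb m) aw == take N e) && (mask m aw == drop N e).
have dropE (N : 'I_n.+1) :
    drop_prob R (rev aw) (rev (take N e)) (rev (drop N e)) * 'C(n, N)%:R =
    \sum_(m : n.-tuple bool) (D N m)%:R.
  have szt : size (rev (take N e)) = N.
    by rewrite size_rev size_takel// sze -ltnS.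
  rewrite -[X in 'C(_, X)]szt drop_prob_masks ?size_rev//; last first.
    by rewrite -size_cat cat_take_drop.
  (* Cards are dropped from the bottom, while masks are read from the top. *)
  rewrite (reindex_inj (h := fun m : n.-tuple bool => [tuple of rev m])) /=; last first.
    by move=> m1 m2 /(congr1 val) /= /(can_inj revK) m12; apply: val_inj.
  apply: eq_bigr => m _; have szm : size m = size aw by rewrite size_tuple sza.
  have szm' : size (map negb m) = size aw by rewrite size_map.
  by rewrite /D map_rev -(rev_mask szm) -(rev_mask szm') !(can_eq revK).
rewrite /riffle.
transitivity (\sum_(N < n.+1) \sum_(m : n.-tuple bool)
    theta ^+ N * (1 - theta) ^+ (n - N) * (D N m)%:R).
  apply: eq_bigr => N _; rewrite -mulr_sumr -dropE /binomial_pmf -mulr_natr.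
  rewrite /unstable.onem; move: (drop_prob _ _ _ _) => d; ring.
rewrite exchange_big /label_measure /=.
rewrite [RHS](reindex (fun t : n.-tuple bool => [ffun i => tnth t i])) /=; last first.
  exists (fun f : {ffun 'I_n -> bool} => [tuple f i | i < n]).
    by move=> t _; apply: eq_from_tnth => i; rewrite tnth_mktuple ffunE.
  by move=> f _; apply/ffunP => i; rewrite ffunE tnth_mktuple.
apply: eq_bigr => m _.
have -> : standardizes (fun i => nat_of_bool ([ffun i => tnth m i] i)) w
    = standardizes (fun i => nat_of_bool (tnth m i)) w.
  by congr standardizes; apply: funext => i; rewrite ffunE.
rewrite -arrangement_masks -/aw.
pose N0 := size (mask (map negb m) aw).
have N0E : N0 = count negb m.
  have szm : size (map negb m) = size aw by rewrite size_map size_tuple sza.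
  by rewrite /N0 (size_mask szm) count_map.
have N0n : (N0 < n.+1)%N by rewrite ltnS N0E -[leqRHS](size_tuple m) count_size.
(* Only one cut is compatible with the mask m, since m fixes the size of the piles. *)
rewrite (bigD1 (Ordinal N0n)) //= [X in _ + X]big1 ?addr0; last first.
  move=> N NN0; rewrite (_ : D N m = false) ?mulr0//.
  apply: contraNF NN0 => /andP[/eqP h _]; apply/eqP/val_inj => /=.
  by rewrite /N0 h size_takel// sze -ltnS.
rewrite mulrC; congr (_ %:R * _).
  rewrite -[enum 'I_n](cat_take_drop N0) eqseq_cat ?size_takel//.
  by rewrite -/e sze -ltnS.
rewrite (eq_bigr (fun i => bit_weight theta (tnth m i))) => [|i _]; last first.
  by rewrite ffunE.
rewrite -(big_tuple _ _ m xpredT (bit_weight theta)).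
have -> : (n - N0)%N = count id m.
  by rewrite N0E -[n in (n - _)%N](size_tuple m) -(count_predC id m) addnK.
rewrite N0E; elim: (tval m) => [|b s IHs]; first by rewrite big_nil mulr1.
by rewrite big_cons -IHs; case: b => /=; rewrite exprS; ring.
Qed.

(** * Distances to uniform after k shuffles *)

(** The alphabet consists of words of length k, built one letter at a time. The
bound B on the ranks is what allows the next letter to be put in front. *)
Lemma riffle_pow_words (R : realType) (theta : R) (k : nat) :
  0 <= theta <= 1 ->
  exists (T : finType) (rk : T -> nat) (p : T -> R) (B : nat),
  [/\ injective rk, (forall x, rk x < B)%N,
      (forall x, 0 <= p x <= Num.max theta (1 - theta) ^+ k),
      (forall j, \sum_x p x ^+ j = (theta ^+ j + (1 - theta) ^+ j) ^+ k)
    & forall n (w : 'S_n), riffle_pow theta k w = label_measure rk p w].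
Proof.
move=> /andP[t0 t1]; set M := Num.max _ _.
have tM : theta <= M by rewrite le_max lexx.
have t'M : 1 - theta <= M by rewrite le_max lexx orbT.
have bM b : 0 <= bit_weight theta b <= M.
  by case: b => /=; rewrite ?t'M ?tM ?andbT// subr_ge0.
elim: k => [|k [T [rk [p [B [rk_inj rkB pM psumE powE]]]]]].
  exists unit, (fun=> 0%N), (fun=> 1), 1%N; split => //.
  - by move=> [] [].
  - by move=> x; rewrite expr0 ler01 lexx.
  - by move=> j; rewrite sumr_const card_unit expr1n expr0.
  - by move=> n w; rewrite label_measure_unit.
exists (bool * T)%type, (fun x => nat_of_bool x.1 * B + rk x.2)%N,
  (fun x => bit_weight theta x.1 * p x.2), (B + B)%N; split.
- move=> [b x] [b' y] /= xy; have xB := rkB x; have yB := rkB y.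
  have bb : b = b' by case: b b' xy => [] [] /=; lia.
  by subst b'; congr (_, _); apply: rk_inj; lia.
- by move=> [b x] /=; have := rkB x; case: b; lia.
- move=> [b x] /=; have /andP[p0 p1] := pM x; have /andP[b0 b1] := bM b.
  by rewrite mulr_ge0//= exprS ler_pM.
- move=> j; rewrite exprS -psumE.
  have -> : theta ^+ j + (1 - theta) ^+ j = \sum_b bit_weight theta b ^+ j.
    by rewrite big_bool /= addrC.
  rewrite big_distrlr /= pair_big /=.
  by apply: eq_bigr => -[b x] _ /=; rewrite exprMn.
- move=> n w; rewrite /riffle_pow iterS -/(riffle_pow theta k).
  rewrite -convolution_label_measure//; apply: eq_bigr => v _.
  by rewrite riffle_label_measure powE.
Qed.

Lemma max_perm_le (R : realType) (n : nat) (f : 'S_n -> R) (b : R) :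
  (forall w, f w <= b) -> max_perm f <= b.
Proof. by move=> fb; apply: bigmax_le => // w _; exact: fb. Qed.

Lemma le_max_perm (R : realType) (n : nat) (f : 'S_n -> R) w :
  f w <= max_perm f.
Proof. exact: le_bigmax. Qed.

Lemma riffle_pow_extremes (R : realType) (theta : R) (n k : nat) :
  0 <= theta <= 1 -> exists s : seq R,
  [/\ (forall x, x \in s -> 0 <= x <= Num.max theta (1 - theta) ^+ k),
      (forall j, psum s j = (theta ^+ j + (1 - theta) ^+ j) ^+ k),
      SEP theta n k = 1 - n`!%:R * elementary_sym s n,
      n`!%:R * complete_sym s n - 1 <= linfty theta n k
    & linfty theta n k <=
        Num.max (n`!%:R * complete_sym s n - 1) (1 - n`!%:R * elementary_sym s n)].
Proof.
move=> /(riffle_pow_words k)[T [rk [p [B [rk_inj _ pM psumE powE]]]]].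
have [hE eE] := monotone_sum_symmetric p n rk_inj.
exists (letter_weights rk p).
set e := elementary_sym _ in eE *; set h := complete_sym _ in hE *.
have p0 x : 0 <= p x by have /andP[] := pM x.
have f0 : 0 < n`!%:R :> R by rewrite ltr0n fact_gt0.
have ratioE (w : 'S_n) : riffle_pow theta k w / uniform_perm R w
    = n`!%:R * label_measure rk p w.
  by rewrite /uniform_perm invrK powE mulrC.
have ge (w : 'S_n) : n`!%:R * e n <= n`!%:R * label_measure rk p w.
  by rewrite ler_pM2l// -eE; exact: label_measure_ge.
have le (w : 'S_n) : n`!%:R * label_measure rk p w <= n`!%:R * h n.
  by rewrite ler_pM2l// -hE; exact: label_measure_le.
split.
- by move=> x /mapP[y _ ->].
- by move=> j; rewrite psum_letter_weights.
- apply/eqP; rewrite eq_le /SEP max_perm_le => [|w]; last by rewrite ratioE lerB.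
  rewrite -eE -label_measure_rev -powE.
  apply: le_trans (le_max_perm _ (perm (@rev_ord_inj n))).
  by rewrite ratioE powE.
- rewrite -hE -label_measure_id.
  apply: le_trans (le_max_perm _ 1%g).
  by rewrite ratioE distrC ler_norm.
- apply: max_perm_le => w; rewrite ratioE le_max.
  have := ge w; have := le w; move: (n`!%:R * label_measure _ _ _) => z zh ez.
  case: (leP z 1) => z1.
    by apply/orP; right; rewrite ger0_norm; lra.
  by apply/orP; left; rewrite ltr0_norm; lra.
Qed.

(** The inequality expR lam - 1 >= 1 - expR (- lam) shows that the upper bound
1 - n! e_n on the values of the second distance does no harm. *)
Lemma riffle_distance_bounds (R : realType) (theta : R) (n k : nat)
    (lam := n%:R ^+ 2 * (theta ^+ 2 + (1 - theta) ^+ 2) ^+ k / 2)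
    (d := n%:R * Num.max theta (1 - theta) ^+ k)
    (err := (12 * lam + 1) * expR (6 * lam) * d) :
  0 <= theta <= 1 -> d <= 1 / 2 ->
  `|SEP theta n k - (1 - expR (- lam))| <= err /\
  `|linfty theta n k - (expR lam - 1)| <= err.
Proof.
move=> t01 d2; have [s [sM psumE -> linf_ge linf_le]] := riffle_pow_extremes n k t01.
have s1 : psum s 1 = 1 by rewrite psumE !expr1 addrC subrK expr1n.
have L2 : n%:R ^+ 2 * psum s 2 = 2 * lam by rewrite psumE /lam; field.
have asym eps (a : nat -> R) : `|eps| <= 1 -> newton eps s a ->
    `|n`!%:R * a n - expR (eps * lam)| <= err.
  move=> eps1 an; have := newton_asymptotics eps1 an s1 sM d2.
  have -> : n%:R ^+ 2 * psum s 2 / 2 = lam by rewrite L2; field.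
  rewrite L2 /err -/d.
  have -> : 6 * (2 * lam) = 12 * lam by ring.
  by have -> : 3 * (2 * lam) = 6 * lam by ring.
have := asym _ _ _ (newton_elementary_sym s); rewrite normrN1 mulN1r => /(_ (lexx _)).
have := asym _ _ _ (newton_complete_sym s); rewrite normr1 mul1r => /(_ (lexx _)).
move: linf_ge linf_le; move: (n`!%:R * _) (n`!%:R * _) => h e.
rewrite le_max => hl le /ler_normlP[h1 h2] /ler_normlP[e1 e2].
have el := expR_ge1Dx lam; have el' := expR_ge1Dx (- lam).
by split; apply/ler_normlP; split; lra.
Qed.

(** * Asymptotics *)

Local Open Scope classical_set_scope.

(** The last inequality is what makes collisions of three or more words negligible
whenever the number of pairwise collisions is bounded. *)
Lemma bit_moment_bounds (R : realType) (theta : R) : 0 < theta < 1 ->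
  [/\ 0 < theta ^+ 2 + (1 - theta) ^+ 2, theta ^+ 2 + (1 - theta) ^+ 2 < 1
    & Num.max theta (1 - theta) ^+ 2 < theta ^+ 2 + (1 - theta) ^+ 2].
Proof.
move=> /andP[t0 t1]; have t2 : 0 < theta ^+ 2 by rewrite exprn_gt0.
have t2' : 0 < (1 - theta) ^+ 2 by rewrite exprn_gt0// subr_gt0.
split; first exact: addr_gt0.
  by rewrite !expr2; nra.
by rewrite /Num.max; case: ifP => _; lra.
Qed.

Lemma shuffle_time_cvgy (R : realType) (theta c A : R) : 0 < theta < 1 ->
  \forall n \near \oo, A <= shuffle_time theta c n.
Proof.
move=> /bit_moment_bounds[q0 q1 _]; rewrite /shuffle_time.
set q := _ + _ in q0 q1 *.
have D0 : 0 < - ln q by rewrite oppr_gt0 ln_lt0// q0.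
near=> n; rewrite ler_pdivlMr//.
have n0 : 0 < n%:R :> R.
  by rewrite (lt_le_trans ltr01)//; near: n; exact: nbhs_infty_ger.
have : (A * - ln q + ln 2 - c) / 2 <= ln n%:R.
  rewrite -[leLHS]expRK ler_ln ?posrE ?expR_gt0//.
  by near: n; exact: nbhs_infty_ger.
lra.
Unshelve. all: by end_near. Qed.

(** The shift is defined so that the expected number of pairs of equal words,
about n^2 / 2 times the probability q^k of a coincidence, is exp(- shift). *)
Lemma expR_rounded_shift (R : realType) (theta c : R) (n : nat) :
  0 < theta < 1 -> (0 < n)%N ->
  expR (- rounded_shift theta c n) =
  n%:R ^+ 2 * (theta ^+ 2 + (1 - theta) ^+ 2) ^+ shuffle_count theta c n / 2.
Proof.
move=> /bit_moment_bounds[q0 _ _] n0; rewrite /rounded_shift.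
set q := _ + _ in q0 *; set k := shuffle_count _ _ _.
have nR0 : 0 < n%:R :> R by rewrite ltr0n.
have -> : - (k%:R * - ln q - (2 * ln n%:R - ln 2))
    = k%:R * ln q + 2%:R * ln n%:R - ln 2 by ring.
rewrite !expRD !expRM_natl expRN !lnK ?posrE//.
by rewrite [q ^+ k * _]mulrC.
Qed.

(** Rounding down removes less than one shuffle, and one shuffle changes the shift
by - ln q. *)
Lemma rounded_shift_bounds (R : realType) (theta c : R) : 0 < theta < 1 ->
  \forall n \near \oo,
    expR (- c) <= expR (- rounded_shift theta c n)
      <= expR (- (c + ln (theta ^+ 2 + (1 - theta) ^+ 2))).
Proof.
move=> t01; have [q0 q1 _] := bit_moment_bounds t01.
near=> n; rewrite !ler_expR !lerN2 /rounded_shift /shuffle_count.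
have st0 : 0 <= shuffle_time theta c n by near: n; exact: shuffle_time_cvgy.
have := truncn_itv st0; set k := Num.truncn _.
have : shuffle_time theta c n * - ln (theta ^+ 2 + (1 - theta) ^+ 2)
    = 2 * ln n%:R - ln 2 + c.
  by rewrite /shuffle_time divfK// oppr_eq0 lt_eqF// ln_lt0// q0.
set q := _ + _ in q0 q1 *.
have D0 : 0 < - ln q by rewrite oppr_gt0 ln_lt0// q0.
rewrite -natr1 => stE /andP[kst stk]; apply/andP; split.
  have := ler_wpM2r (ltW D0) kst; lra.
have := ler_wpM2r (ltW D0) (ltW stk); rewrite mulrDl; lra.
Unshelve. all: by end_near. Qed.

(** The square of the left-hand side is 2 lam (m^2 / q)^k, where lam is bounded,
m^2 / q < 1 and k tends to infinity. *)
Lemma deck_times_max_weight_small (R : realType) (theta c e : R) :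
  0 < theta < 1 -> 0 < e ->
  \forall n \near \oo,
    n%:R * Num.max theta (1 - theta) ^+ shuffle_count theta c n <= e.
Proof.
move=> t01 e0; have [q0 q1 mq] := bit_moment_bounds t01.
have sb := rounded_shift_bounds c t01.
set q := _ + _ in q0 q1 mq sb *; set M := Num.max _ _ in mq *.
have M0 : 0 <= M by rewrite le_max (ltW (andP t01).1).
set Lam := expR (- (c + ln q)) in sb.
have Lam0 : 0 < Lam by exact: expR_gt0.
pose rho := M ^+ 2 / q.
have rho0 : 0 <= rho by rewrite divr_ge0 ?exprn_ge0// ltW.
have rho1 : rho < 1 by rewrite ltr_pdivrMr// mul1r.
(* The factor 2 * Lam is the bound on n^2 q^k. *)
have [K rhoK] : exists K, forall k, (K <= k)%N -> 2 * Lam * rho ^+ k <= e ^+ 2.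
  have rho_norm : `|rho| < 1 by rewrite ger0_norm.
  have := cvg_expr rho_norm; move/cvgrPdist_le/(_ (e ^+ 2 / (2 * Lam))).
  have h0 : 0 < e ^+ 2 / (2 * Lam).
    by apply: divr_gt0; [exact: exprn_gt0|exact: mulr_gt0].
  move=> /(_ h0) [K _ HK]; exists K => k /HK /=.
  rewrite sub0r normrN ger0_norm ?exprn_ge0// ler_pdivlMr ?mulr_gt0//.
  by rewrite mulrC.
near=> n.
have n0 : (0 < n)%N by near: n; exists 1%N.
have kK : (K <= shuffle_count theta c n)%N.
  rewrite truncn_ge_nat; first by near: n; exact: shuffle_time_cvgy.
  by near: n; exact: shuffle_time_cvgy.
have /andP[_] : expR (- c) <= expR (- rounded_shift theta c n) <= Lam.
  by near: n.
rewrite expR_rounded_shift// -/q; set k := shuffle_count _ _ _ in kK *.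
move=> lamL; rewrite -(@ler_pXn2r _ 2) ?nnegrE ?mulr_ge0 ?exprn_ge0 ?(ltW e0)//.
apply: le_trans (rhoK k kK).
have sqE j : (n%:R * M ^+ j) ^+ 2 = 2 * (n%:R ^+ 2 * q ^+ j / 2) * rho ^+ j.
  have qj0 : q ^+ j != 0 by rewrite expf_neq0// gt_eqF.
  rewrite exprMn /rho expr_div_n -[in LHS]exprM mulnC exprM.
  by move: (q ^+ j) qj0 ((M ^+ 2) ^+ j) => u u0 v; field.
rewrite sqE.
by rewrite ler_wpM2r ?exprn_ge0// ler_pM2l.
Unshelve. all: by end_near. Qed.

Lemma ratio_cvg1 (R : realType) (f g : nat -> R) (g0 : R) : 0 < g0 ->
  (\forall n \near \oo, g0 <= g n) ->
  (forall e, 0 < e -> \forall n \near \oo, `|f n - g n| <= e) ->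
  f n / g n @[n --> \oo] --> (1 : R).
Proof.
move=> g00 gn fg; apply/cvgrPdist_le => e e0; near=> n.
have gg : g0 <= g n by near: n.
have gn0 : 0 < g n by exact: lt_le_trans gg.
have -> : 1 - f n / g n = - (f n - g n) / g n by field; rewrite gt_eqF.
rewrite normrM normrN normfV (gtr0_norm gn0) ler_pdivrMr//.
apply: (@le_trans _ _ (e * g0)); last by rewrite ler_pM2l.
by near: n; apply: fg; exact: mulr_gt0.
Unshelve. all: by end_near. Qed.

Lemma distance_error_homo (R : realType) (l L : R) : 0 < l <= L ->
  (12 * l + 1) * expR (6 * l) <= (12 * L + 1) * expR (6 * L).
Proof.
move=> /andP[l0 lL]; apply: ler_pM; rewrite ?expR_ge0 ?ler_expR//; lra.
Qed.

Theorem theorem1 (R : realType) (theta : R) (htheta : 0 < theta < 1) (c : R) :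
  (SEP theta n (shuffle_count theta c n)
     / (1 - expR (- expR (- rounded_shift theta c n))) @[n --> \oo] --> (1 : R))
  /\
  (linfty theta n (shuffle_count theta c n)
     / (expR (expR (- rounded_shift theta c n)) - 1) @[n --> \oo] --> (1 : R)).
Proof.
move: htheta => /[dup] t01 /andP[t0 t1]; have t01' : 0 <= theta <= 1 by rewrite !ltW.
set q := theta ^+ 2 + (1 - theta) ^+ 2; pose Lam := expR (- (c + ln q)).
pose lam n := expR (- rounded_shift theta c n).
pose C := (12 * Lam + 1) * expR (6 * Lam).
have Lam0 : 0 < Lam by exact: expR_gt0.
have C0 : 0 < C by rewrite mulr_gt0 ?expR_gt0//; lra.
have bounds : \forall n \near \oo, expR (- c) <= lam n <= Lam.
  exact: rounded_shift_bounds.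
have close e : 0 < e -> \forall n \near \oo,
    `|SEP theta n (shuffle_count theta c n) - (1 - expR (- lam n))| <= e /\
    `|linfty theta n (shuffle_count theta c n) - (expR (lam n) - 1)| <= e.
  move=> e0; near=> n.
  have n0 : (0 < n)%N by near: n; exists 1%N.
  have lamE : lam n = n%:R ^+ 2 * q ^+ shuffle_count theta c n / 2.
    exact: expR_rounded_shift.
  have d2 : n%:R * Num.max theta (1 - theta) ^+ shuffle_count theta c n <= 1 / 2.
    by near: n; exact: deck_times_max_weight_small.
  have [h1 h2] := riffle_distance_bounds t01' d2.
  move: h1 h2; rewrite -/q -lamE.
  set d := n%:R * _ in d2 *.
  have d0 : 0 <= d by rewrite mulr_ge0// exprn_ge0// le_max ltW.
  suff : (12 * lam n + 1) * expR (6 * lam n) * d <= e.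
    by move=> he h1 h2; split; [exact: le_trans h1 he|exact: le_trans h2 he].
  have /andP[_ lamL] : expR (- c) <= lam n <= Lam by near: n.
  have lam0 : 0 < lam n by exact: expR_gt0.
  apply: (@le_trans _ _ (C * d)).
    by rewrite ler_wpM2r// distance_error_homo// lam0.
  rewrite mulrC -ler_pdivlMr//.
  rewrite /d; near: n; apply: deck_times_max_weight_small => //.
  exact: divr_gt0.
have ec0 : 0 < expR (- c) by exact: expR_gt0.
split.
  apply: (@ratio_cvg1 _ _ _ (1 - expR (- expR (- c)))).
  - by rewrite subr_gt0 -expR0 ltr_expR oppr_lt0.
  - near=> n; have /andP[h _] : expR (- c) <= lam n <= Lam by near: n.
    by rewrite lerB// ler_expR lerN2.
  - by move=> e /close; apply: filterS => n [].
apply: (@ratio_cvg1 _ _ _ (expR (expR (- c)) - 1)).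
- by rewrite subr_gt0 -expR0 ltr_expR.
- near=> n; have /andP[h _] : expR (- c) <= lam n <= Lam by near: n.
  by rewrite lerB// ler_expR.
- by move=> e /close; apply: filterS => n [].
Unshelve. all: by end_near. Qed.
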